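(* Let $G\neq K_2$ be a connected graph belonging to the class $\mathbf{W}_2$. Then: (i) for each $v\in V(G)$ there exist two disjoint sets $S_1,S_2\in\Omega(G)$ with $v\notin S_1\cup S_2$; (ii) $|V(G)|\ge 2\alpha(G)+1$; (iii) for every $u,v\in V(G)$ there is $S\in\Omega(G)$ with $S\cap\{u,v\}=\emptyset$; (iv) $\alpha(G)\le\mu(G)$ and $\alpha(G)+\mu(G)\le|V(G)|-1$; (v) $\alpha(G)=\alpha(G-S)$ for every independent set $S$; (vi) if $A\subseteq B$ and $B$ is independent, then $\partial(A)\le\partial(B)$; (vii) $G$ is regularizable and $|B|<|N(B)|$ for every non-empty independent set $B$; (viii) $|A|\le\alpha(G[N(A)])$ for every independent set $A$; (ix) for every independent set $A$ there exist an independent set $T$ and a matching $M$ such that every vertex of $A$ is matched by $M$ with a vertex of $T$.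
   Context: Graphs are finite, simple, undirected. An independent set is a set of pairwise non-adjacent vertices; $\alpha(G)$ is the maximum size of an independent set and $\Omega(G)$ the family of independent sets of size $\alpha(G)$. A graph belongs to $\mathbf{W}_2$ if every two disjoint independent sets are included, respectively, in two disjoint maximum independent sets. $\mu(G)$ is the maximum size of a matching. For $A\subseteq V(G)$, $N(A)=\{v: N(v)\cap A\neq\emptyset\}$, $G[X]$ is the induced subgraph on $X$, $G-S$ is the subgraph induced by $V(G)\setminus S$, and the differential of $A$ is $\partial(A)=|N(A)\setminus A|-|A|$. A graph is regularizable if, by replacing each edge by a positive integer number of parallel copies, one obtains a regular multigraph of non-zero degree. *)

(* Defs.v *)
From HB Require Import structures.
From mathcomp Require Import all_boot all_order all_algebra.

Set Implicit Arguments.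
Unset Strict Implicit.
Unset Printing Implicit Defensive.

Record sgraph := SGraph {
  vertex :> finType;
  adj : rel vertex;
  adj_sym : symmetric adj;
  adj_irrefl : irreflexive adj }.

Lemma complete_sym n : symmetric (fun x y : 'I_n => x != y).
Proof. by move=> x y; rewrite eq_sym. Qed.

Lemma complete_irrefl n : irreflexive (fun x y : 'I_n => x != y).
Proof. by move=> x; rewrite eqxx. Qed.

Definition complete n : sgraph :=
  SGraph (@complete_sym n) (@complete_irrefl n).

Definition isomorphic (G H : sgraph) : Prop :=
  exists2 f : G -> H, bijective f & forall x y, adj (f x) (f y) = adj x y.

Section Graph.
Variable G : sgraph.
Implicit Types (A B S : {set G}) (M : {set {set G}}).

(* The graph with no vertex is not connected. *)
Definition connected : Prop :=
  0 < #|G| /\ forall x y : G, connect (@adj G) x y.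

Definition independent A : bool :=
  [forall x in A, forall y in A, ~~ adj x y].

Definition alpha : nat := \max_(A : {set G} | independent A) #|A|.

Definition Omega : {set {set G}} :=
  [set A : {set G} | independent A & #|A| == alpha].

Definition W2 : Prop :=
  forall A B, independent A -> independent B -> [disjoint A & B] ->
  exists S1 S2 : {set G},
    [/\ S1 \in Omega, S2 \in Omega, A \subset S1, B \subset S2
      & [disjoint S1 & S2]].

Definition nbhd (v : G) : {set G} := [set u | adj v u].

(* Open neighborhood: [nbhs A] may meet [A] when [A] is not independent. *)
Definition nbhs A : {set G} := [set v | nbhd v :&: A != set0].

Definition differential A : int :=
  (#|nbhs A :\: A|%:Z - #|A|%:Z)%R.

Definition edges : {set {set G}} :=
  [set e | [exists x, exists y, adj x y && (e == [set x; y])]].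

Definition matching M : bool := (M \subset edges) && trivIset M.

Definition mu : nat := \max_(M : {set {set G}} | matching M) #|M|.

(* [m e] is the number of parallel copies replacing the edge [e]; the sum is
   the degree of [v] in the resulting multigraph. *)
Definition regularizable : Prop :=
  exists m : {set G} -> nat, (forall e, e \in edges -> 0 < m e) /\
  exists2 d : nat, 0 < d &
    forall v : G, \sum_(e in edges | v \in e) m e = d.

Definition induced_adj (S : {set G}) : rel {x : G | x \in S} :=
  fun x y => adj (val x) (val y).

Lemma induced_sym S : symmetric (@induced_adj S).
Proof. by move=> x y; apply: adj_sym. Qed.

Lemma induced_irrefl S : irreflexive (@induced_adj S).
Proof. by move=> x; apply: adj_irrefl. Qed.

Definition induced S : sgraph := SGraph (@induced_sym S) (@induced_irrefl S).

Definition remove S : sgraph := induced (~: S).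

End Graph.

(* Main.v *)
Require Import Defs.
From HB Require Import structures.
From mathcomp Require Import all_boot all_order all_algebra.
From mathcomp Require Import all_fingroup zify.

Set Implicit Arguments.
Unset Strict Implicit.
Unset Printing Implicit Defensive.

(** If [S] is a maximum independent set and [C] an independent set disjoint
    from it, exchanging [N(C) :&: S] for [C] in [S] gives [|C| <= |N(C) :&: S|].
    In W2 every independent set [A] sits in a maximum independent set disjoint
    from another one [S], so Hall's theorem matches [A] into [S]; the same
    inequality for [C = B \ A] and [S] containing [A] gives the monotonicity of
    the differential.  Two prescribed distinct neighbours of [v] keep [v] out of
    both maximum independent sets, and a connected W2 graph other than [K_2] has
    minimum degree at least two.

    For regularizability, [|B| < |N(B)|] for non-empty independent [B] extends
    to [|X| < |N(X)|] for all proper non-empty [X], by splitting off the isolated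
    vertices of [G[X]].  Hall's theorem then gives, for every edge [xy], a
    permutation [s] moving every vertex to a neighbour and sending [x] to [y].
    Each such permutation puts total weight 2 at each vertex when every edge
    [{u, s u}] is counted once for each [u]; summing over all of them yields
    positive weights. *)

(** * Hall's marriage theorem *)

Section Hall.
Variables (T U : finType).
Implicit Types (N : T -> {set U}) (A X : {set T}).

(** Induction on [#|A|]. If a non-empty proper subset [X] is tight, with at most [#|X|] neighbours,
    match [X] first and [A :\: X] outside its neighbours; otherwise any [a] may take any [b]. [u0]
    supplies the function when [A] is empty. *)
Lemma hall (u0 : U) N A :
  (forall X, X \subset A -> #|X| <= #|\bigcup_(x in X) N x|) ->
  exists2 f : T -> U, {in A &, injective f} & {in A, forall x, f x \in N x}.
Proof.
elim: {A}_.+1 {-2}A (ltnSn #|A|) N => // n IH A; rewrite ltnS => leAn N hall.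
have [->|[a aA]] := set_0Vmem A.
  by exists (fun=> u0) => [x y|x]; rewrite inE.
have [/existsP[X /and4P[sXA X0 XA tX]]|/existsPn noX] := boolP [exists X : {set T},
  [&& X \subset A, X != set0, X != A & #|\bigcup_(x in X) N x| <= #|X|]].
- have ltX : #|X| < n.
    by apply: leq_trans leAn; apply: proper_card; rewrite properEneq XA.
  have X_gt0 : 0 < #|X| by rewrite card_gt0.
  have cAX := cardsID X A; rewrite (setIidPr sXA) in cAX.
  have ltD : #|A :\: X| < n by lia.
  have [Y sYX|f injf fN] := IH X ltX N.
    by apply: hall; apply: subset_trans sXA.
  pose NX := \bigcup_(x in X) N x.
  have [Y sYD|g injg gN] := IH (A :\: X) ltD (fun x => N x :\: NX).
    have dXY : [disjoint X & Y].
      by rewrite disjoint_sym; move: sYD; rewrite subsetD => /andP[].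
    have sYA : Y \subset A by move: sYD; rewrite subsetD => /andP[].
    (* Hall's condition for [X :|: Y], less the tight part [X], is the condition for [Y]. *)
    have := hall (X :|: Y); rewrite subUset sXA sYA => /(_ isT).
    rewrite cardsU (disjoint_setI0 dXY) cards0 subn0.
    have -> : \bigcup_(x in X :|: Y) N x =
              NX :|: \bigcup_(x in Y) (N x :\: NX).
      apply/setP=> u; rewrite in_setU; apply/bigcupP/orP => [[x]|].
        rewrite inE => /orP[xX ux|xY ux]; first by left; apply/bigcupP; exists x.
        case: (boolP (u \in NX)) => uN; [by left|right].
        by apply/bigcupP; exists x; rewrite // inE uN.
      case=> /bigcupP[x xY ux]; exists x; rewrite ?inE ?xY ?orbT //.
      by move: ux; rewrite inE => /andP[].
    move=> h; have := leq_trans h (leq_card_setU _ _).1.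
    move: tX; rewrite -/NX; lia.
  exists (fun x => if x \in X then f x else g x) => [x y xA yA|x xA].
    have NXf z : z \in X -> f z \in NX by move=> zX; apply/bigcupP; exists z; auto.
    have NXg z : z \in A -> z \notin X -> g z \notin NX.
      by move=> zA zX; have := gN z; rewrite !inE zX zA => /(_ isT)/andP[].
    case: ifPn => xX; case: ifPn => yX; first exact: injf.
    - by move=> e; case/negP: (NXg _ yA yX); rewrite -e NXf.
    - by move=> e; case/negP: (NXg _ xA xX); rewrite e NXf.
    by apply: injg; rewrite inE ?xX ?yX.
  case: ifPn => xX; first exact: fN.
  by have := gN x; rewrite !inE xX xA => /(_ isT)/andP[].
- have [b bNa] : exists b, b \in N a.
    apply/set0Pn; rewrite -card_gt0.
    by have := hall [set a]; rewrite sub1set cards1 big_set1 => /(_ aA).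
  have ltA : #|A :\ a| < n by move: leAn; rewrite (cardsD1 a) aA; lia.
  have [Y|g injg gN] := IH _ ltA (fun x => N x :\ b).
    rewrite subsetD1 => /andP[sYA aY].
    have [->|Y0] := eqVneq Y set0; first by rewrite cards0.
    have YA : Y != A by apply: contraNneq aY => ->.
    (* [Y] is not tight, so it has a neighbour to spare and can lose [b]. *)
    have := noX Y; rewrite sYA Y0 YA /= -ltnNge.
    have -> : \bigcup_(x in Y) (N x :\ b) = (\bigcup_(x in Y) N x) :\ b.
      apply/setP=> u; rewrite in_setD1.
      apply/bigcupP/andP => [[x xY]|[ub /bigcupP[x xY ux]]].
        by rewrite in_setD1 => /andP[ub ux]; split=> //; apply/bigcupP; exists x.
      by exists x; rewrite // in_setD1 ub.
    by rewrite (cardsD1 b (\bigcup_(x in Y) N x)); lia.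
  have gP x : x \in A -> x != a -> g x != b /\ g x \in N x.
    by move=> xA xa; have := gN x; rewrite !inE xA xa => /(_ isT)/andP[].
  exists (fun x => if x == a then b else g x) => [x y xA yA|x xA].
    case: eqVneq => [->|xa]; case: eqVneq => [->|ya] // e.
    - by have [] := gP y yA ya; rewrite -e eqxx.
    - by have [] := gP x xA xa; rewrite e eqxx.
    by apply: injg; rewrite ?inE ?xa ?ya.
  by case: eqVneq => [->|xa] //; have [] := gP x xA xa.
Qed.

End Hall.

(** * Independent sets, exchange and matchings *)

Section Graph.
Variable G : sgraph.
Implicit Types (A B C S X : {set G}) (x y u v : G).

Lemma independentP A :
  reflect {in A &, forall x y, ~~ adj x y} (independent A).
Proof.
apply: (iffP forall_inP) => [h x y xA yA|h x xA].
  by move/forall_inP: (h x xA); apply.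
by apply/forall_inP=> y yA; apply: h.
Qed.

Lemma independentW A B : A \subset B -> independent B -> independent A.
Proof.
by move=> /subsetP sAB /independentP iB; apply/independentP=> x y /sAB xB /sAB; apply: iB.
Qed.

Lemma independent0 : independent (set0 : {set G}).
Proof. by apply/independentP=> x y; rewrite inE. Qed.

Lemma independent1 v : independent [set v].
Proof. by apply/independentP=> x y /set1P-> /set1P->; rewrite adj_irrefl. Qed.

Lemma leq_alpha A : independent A -> #|A| <= alpha G.
Proof. by move=> iA; apply: (leq_bigmax_cond (F := fun A : {set G} => #|A|)). Qed.

Lemma OmegaP S : reflect (independent S /\ #|S| = alpha G) (S \in Omega G).
Proof. by rewrite inE; apply: (iffP andP) => -[? /eqP]. Qed.

Lemma nbhsP A v : reflect (exists2 u, u \in A & adj u v) (v \in nbhs A).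
Proof.
rewrite inE; apply: (iffP (set0Pn _)) => [[u]|[u uA uv]].
  by rewrite !inE => /andP[vu uA]; exists u; rewrite // adj_sym.
by exists u; rewrite !inE adj_sym uv.
Qed.

Lemma nbhsS A B : A \subset B -> nbhs A \subset nbhs B.
Proof.
move=> /subsetP sAB; apply/subsetP=> v /nbhsP[u /sAB uB uv].
by apply/nbhsP; exists u.
Qed.

Lemma nbhs_disjoint A : independent A -> nbhs A :\: A = nbhs A.
Proof.
move=> /independentP iA; apply/setDidPl; rewrite -setI_eq0; apply/eqP/setP=> v.
rewrite in_setI in_set0; apply/andP=> -[/nbhsP[u uA uv] vA].
by have := iA u v uA vA; rewrite uv.
Qed.

Lemma Omega_exchange S C : S \in Omega G -> independent C -> [disjoint C & S] ->
  #|C| <= #|nbhs C :&: S|.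
Proof.
move=> /OmegaP[/independentP iS cS] /independentP iC dCS.
have/leq_alpha : independent ((S :\: nbhs C) :|: C).
  apply/independentP=> x y; rewrite !in_setU !in_setD.
  have nC z t : z \notin nbhs C -> t \in C -> ~~ adj t z.
    by move=> zC tC; apply: contra zC => tz; apply/nbhsP; exists t.
  case/orP=> [/andP[xC xS]|xC]; case/orP=> [/andP[yC yS]|yC].
  - exact: iS.
  - by rewrite adj_sym; apply: nC.
  - exact: nC.
  exact: iC.
have d : (S :\: nbhs C) :&: C = set0.
  apply/setP=> z; rewrite !inE; apply/andP=> -[/andP[_ zS] zC].
  by have := disjointFr dCS zC; rewrite zS.
rewrite cardsU d cards0 subn0 -cS.
by have := cardsID (nbhs C) S; rewrite [S :&: _]setIC; lia.
Qed.

(** Subsets of [A] are again independent and disjoint from [S], so the exchange inequality for them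
    is Hall's condition inside [S]. *)
Lemma hall_Omega S A : S \in Omega G -> independent A -> [disjoint A & S] ->
  exists2 f : G -> G, {in A &, injective f}
    & {in A, forall x, adj x (f x) /\ f x \in S}.
Proof.
move=> OS iA dAS; have [->|[a0 _]] := set_0Vmem A.
  by exists id => // x; rewrite inE.
have [X sXA|f injf fN] := @hall G G a0 (fun x => nbhd x :&: S) A; last first.
  by exists f => // x xA; have := fN x xA; rewrite !inE => /andP.
have -> : \bigcup_(x in X) (nbhd x :&: S) = nbhs X :&: S.
  apply/setP=> v; rewrite in_setI; apply/bigcupP/andP.
    by case=> u uX /setIP[]; rewrite [_ \in nbhd _]inE => uv vS; split=> //; apply/nbhsP; exists u.
  by case=> /nbhsP[u uX uv] vS; exists u; rewrite // !inE uv.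
apply: Omega_exchange => //; first exact: independentW iA.
exact: disjointWl dAS.
Qed.

Lemma matching_of_injection S A (f : G -> G) : [disjoint A & S] ->
  {in A &, injective f} -> {in A, forall x, adj x (f x) /\ f x \in S} ->
  matching [set [set x; f x] | x in A]
  /\ #|[set [set x; f x] | x in A]| = #|A|.
Proof.
move=> dAS injf fP.
have meet x y z : x \in A -> y \in A ->
    z \in [set x; f x] -> z \in [set y; f y] -> x = y.
  move=> xA yA; have [_ fxS] := fP x xA; have [_ fyS] := fP y yA.
  rewrite !inE => /orP[]/eqP-> /orP[]/eqP e //; last exact: injf.
  - by have := disjointFr dAS xA; rewrite e fyS.
  - by have := disjointFr dAS yA; rewrite -e fxS.
split; last first.
  rewrite card_in_imset // => x y xA yA e.
  by apply: (meet x y x) => //; rewrite -?e set21.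
apply/andP; split.
  apply/subsetP=> _ /imsetP[x xA ->]; rewrite inE.
  by apply/existsP; exists x; apply/existsP; exists (f x); rewrite (fP x xA).1 /=.
apply/trivIsetP=> _ _ /imsetP[x xA ->] /imsetP[y yA ->] ne.
rewrite -setI_eq0; apply: contraNT ne => /set0Pn[z].
by rewrite in_setI => /andP[zx zy]; rewrite (meet x y z).
Qed.

Lemma double_mu : 2 * mu G <= #|G|.
Proof.
rewrite /mu; apply: (big_ind (fun m => 2 * m <= #|G|)) => //; first by move=> *; lia.
move=> M /andP[/subsetP sM tM].
apply: leq_trans (max_card (mem (cover M))).
(* Disjointness makes the number of covered vertices the sum of the edge sizes, each equal to 2. *)
have /eqP <- := tM.
rewrite mulnC -sum_nat_const; apply: leq_sum => e /sM.
rewrite inE => /existsP[x /existsP[y /andP[xy /eqP->]]].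
by rewrite cards2; case: eqVneq xy => // ->; rewrite adj_irrefl.
Qed.

Lemma induced_set_independent S A : A \subset S -> independent A ->
  exists2 B : {set induced S}, independent B & #|B| = #|A|.
Proof.
move=> /subsetP sAS /independentP iA.
exists [set z : induced S | val z \in A].
  apply/forall_inP=> x; rewrite inE => xA; apply/forall_inP=> y; rewrite inE => yA.
  exact: iA.
rewrite -(card_imset _ (@val_inj _ _ {x : G | x \in S})).
apply: eq_card => z; apply/imsetP/idP => [[t]|zA].
  by rewrite inE => tA ->.
by exists (Sub z (sAS z zA)); rewrite ?inE /= ?SubK.
Qed.

End Graph.

Lemma leq_alpha_induced (G : sgraph) (S A : {set G}) :
  A \subset S -> independent A -> #|A| <= alpha (induced S).
Proof.
by move=> sAS iA; have [B iB <-] := induced_set_independent sAS iA; apply: leq_alpha.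
Qed.

Lemma alpha_induced (G : sgraph) (S : {set G}) : alpha (induced S) <= alpha G.
Proof.
apply/bigmax_leqP=> B /independentP iB.
rewrite -(card_imset _ (@val_inj _ _ {x : G | x \in S})).
by apply: leq_alpha; apply/independentP=> _ _ /imsetP[x xB ->] /imsetP[y yB ->]; apply: iB.
Qed.

(** * Regularizability from strict expansion of independent sets *)

Section Regularizable.
Variable G : sgraph.
Hypothesis conn : connected G.
Implicit Types (B X : {set G}) (x y u v : G).

(** Such an [X] is closed under adjacency, hence a union of connected components. *)
Lemma nbhs_fixed X : X != set0 -> nbhs X = X -> X = setT.
Proof.
case/set0Pn=> a aX NX; apply/setP=> b; rewrite inE.
have cX : closed (@adj G) (mem X).
  apply: intro_closed; first exact: sym_connect_sym (@adj_sym G).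
  by move=> x y xy xX; rewrite -NX; apply/nbhsP; exists x.
by rewrite -(closed_connect cX (conn.2 a b)).
Qed.

Hypothesis expand : forall B, B != set0 -> independent B -> #|B| < #|nbhs B|.

Lemma expand_proper X : X != set0 -> X != setT -> #|X| < #|nbhs X|.
Proof.
move=> X0 XT; pose I := X :\: nbhs X.
have iI : independent I.
  apply/independentP=> x y; rewrite !in_setD => /andP[_ xX] /andP[yN _].
  by apply: contra yN => xy; apply/nbhsP; exists x.
have cX : #|X| = #|X :&: nbhs X| + #|I| by rewrite cardsID.
have [I0|I_neq0] := eqVneq I set0.
  have sX : X \subset nbhs X by rewrite -setD_eq0 -/I I0.
  apply: proper_card; rewrite properEneq sX andbT.
  by apply: contraNneq XT => e; apply/eqP/nbhs_fixed.
have lt := expand I_neq0 iI.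
(* A neighbour in [X] of some [u] in [I] would put [u] in [nbhs X]. So [X :&: nbhs X] and [nbhs I]
   are disjoint parts of [nbhs X], the second larger than [I]. *)
have d : (X :&: nbhs X) :&: nbhs I = set0.
  apply/setP=> v; rewrite !in_setI in_set0; apply/andP=> -[/andP[vX _] /nbhsP[u]].
  rewrite in_setD => /andP[/negP uN _] uv; case: uN.
  by apply/nbhsP; exists v; rewrite // adj_sym.
have : #|(X :&: nbhs X) :|: nbhs I| <= #|nbhs X|.
  by apply: subset_leq_card; rewrite subUset subsetIr nbhsS // subsetDl.
by rewrite cardsU d cards0 subn0 cX; lia.
Qed.

(** The cycles of such a permutation form a perfect 2-matching: doubled edges and cycles of [G]. *)
Definition moves_along_edges (s : {perm G}) := [forall v, adj v (s v)].

(** Sets avoiding [x] are proper, so their strict expansion survives the deletion of [y]; Hall's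
    theorem injects the vertices other than [x] into those other than [y], and [x] is sent to
    [y]. *)
Lemma moving_perm x y : adj x y ->
  exists2 s : {perm G}, moves_along_edges s & s x = y.
Proof.
move=> xy; have [X sX|f injf fN] :=
  @hall G G x (fun v => nbhd v :\ y) [set~ x].
  have [->|X0] := eqVneq X set0; first by rewrite cards0.
  have XT : X != setT.
    apply: contraTneq sX => ->; apply/negP => /subsetP/(_ x).
    by rewrite !inE eqxx => /(_ isT).
  have -> : \bigcup_(v in X) (nbhd v :\ y) = nbhs X :\ y.
    apply/setP=> u; rewrite in_setD1; apply/bigcupP/andP.
      by case=> v vX /setD1P[uy]; rewrite [_ \in nbhd _]inE => vu; split=> //; apply/nbhsP; exists v.
    by case=> uy /nbhsP[v vX vu]; exists v; rewrite // !inE uy.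
  by have := expand_proper X0 XT; rewrite (cardsD1 y (nbhs X)); lia.
have fP v : v != x -> f v != y /\ adj v (f v).
  by move=> vx; have := fN v; rewrite !inE vx => /(_ isT)/andP.
pose g v := if v == x then y else f v.
have injg : injective g.
  rewrite /g => u v; case: eqVneq => [->|ux]; case: eqVneq => [->|vx] // e.
  - by have [] := fP v vx; rewrite -e eqxx.
  - by have [] := fP u ux; rewrite e eqxx.
  by apply: injf; rewrite ?inE.
exists (perm injg); last by rewrite permE /g eqxx.
apply/forallP=> v; rewrite permE /g; case: eqVneq => [->//|vx].
by have [] := fP v vx.
Qed.

Lemma moving_perm_degree (s : {perm G}) v : moves_along_edges s ->
  \sum_(e in edges G | v \in e) #|[set u | [set u; s u] == e]| = 2.
Proof.
move=> /forallP ms.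
have -> : \sum_(e in edges G | v \in e) #|[set u | [set u; s u] == e]| =
    \sum_(e in edges G | v \in e) \sum_u ([set u; s u] == e).
  apply: eq_bigr => e _; rewrite -sum1dep_card big_mkcond /=.
  by apply: eq_bigr => u _; case: (_ == _).
rewrite exchange_big /=.
(* The pairs [[set u; s u]] containing [v] come from [u = v] and from the preimage of [v], distinct
   since [s] fixes no vertex. *)
have -> : 2 = #|[set v; (s^-1)%g v]|.
  rewrite cards2; case: eqVneq => // e.
  by have := ms v; rewrite {2}e permKV adj_irrefl.
rewrite -sum1_card [RHS]big_mkcond /=; apply: eq_bigr => u _.
have euE : [set u; s u] \in edges G.
  by rewrite inE; apply/existsP; exists u; apply/existsP; exists (s u); rewrite ms /=.
have -> : (u \in [set v; (s^-1)%g v]) = (v \in [set u; s u]).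
  rewrite !inE [u == v]eq_sym; congr (_ || _).
  by apply/eqP/eqP => ->; rewrite ?permKV ?permK.
case: ifPn => vu.
  rewrite (bigD1 [set u; s u]) ?euE //= eqxx big1 // => e /andP[_ ne].
  by rewrite eq_sym (negPf ne).
rewrite big1 // => e /andP[_ ve]; case: eqVneq => // e_eq.
by rewrite e_eq ve in vu.
Qed.

Lemma regularizable_of_expand x0 y0 : @adj G x0 y0 -> regularizable G.
Proof.
move=> xy0.
exists (fun e => \sum_(s : {perm G} | moves_along_edges s)
                   #|[set u | [set u; s u] == e]|); split.
  move=> e; rewrite inE => /existsP[x /existsP[y /andP[xy /eqP->]]].
  have [s ms sx] := moving_perm xy.
  rewrite (bigD1 s) //= addn_gt0; apply/orP; left.
  by apply/card_gt0P; exists x; rewrite inE sx.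
(* The common degree is twice the number of moving permutations, and the edge [x0 y0] provides
   one. *)
exists (\sum_(s : {perm G} | moves_along_edges s) 2).
  by have [s ms _] := moving_perm xy0; rewrite (bigD1 s).
move=> v; rewrite exchange_big /=; apply: eq_bigr => s ms.
exact: moving_perm_degree.
Qed.

End Regularizable.

(** * Consequences of membership in W2 *)

Section W2.
Variable G : sgraph.
Hypotheses (conn : connected G) (GW2 : W2 G).
Implicit Types (A B S : {set G}) (u v w : G).

(** W2 is applied to the empty set and [A]. *)
Lemma W2_disjoint_Omega A : independent A ->
  exists2 S, S \in Omega G & [disjoint A & S].
Proof.
move=> iA; have [|S1 [S2 [O1 O2 _ sA d]]] := GW2 (independent0 G) iA.
  by rewrite -setI_eq0 set0I.
by exists S1 => //; rewrite disjoint_sym; apply: disjointWr d.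
Qed.

Lemma W2_has_neighbour v : exists u, adj v u.
Proof.
have [S OS dS] := W2_disjoint_Omega (independent1 v).
have := Omega_exchange OS (independent1 v) dS.
rewrite cards1 => /card_gt0P[u]; rewrite in_setI => /andP[/nbhsP[w /set1P->] vu _].
by exists u.
Qed.

Lemma Omega_leaf v u S : (forall w, adj v w = (w == u)) -> S \in Omega G ->
  v \notin S -> u \in S.
Proof.
move=> vE OS vS.
have := Omega_exchange OS (independent1 v).
rewrite disjoints1 cards1 => /(_ vS)/card_gt0P[w].
by rewrite in_setI => /andP[/nbhsP[z /set1P->]]; rewrite vE => /eqP->.
Qed.

(** Otherwise disjoint maximum independent sets contain [v] and [w] respectively; the one with [w]
    misses the leaf [v], so by maximality it contains [u], a neighbour of [w]. *)
Lemma W2_leaf_neighbour v u w : (forall w', adj v w' = (w' == u)) ->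
  adj u w -> w = v.
Proof.
move=> vE uw; apply/eqP; apply: contraT => wv.
have [|S1 [S2 [O1 O2 /subsetP sv /subsetP sw d]]] :=
    GW2 (independent1 v) (independent1 w).
  by rewrite disjoints1 inE eq_sym.
have vS2 : v \notin S2 by rewrite (disjointFr d) // sv ?set11.
have uS2 := Omega_leaf vE O2 vS2.
have /OmegaP[/independentP/(_ u w uS2)] := O2.
by rewrite sw ?set11 // uw => /(_ isT).
Qed.

Hypothesis nK2 : ~ isomorphic G (complete 2).

Lemma W2_two_neighbours v : exists a b, [/\ a != b, adj v a & adj v b].
Proof.
have [u vu] := W2_has_neighbour v.
have [/existsP[b /andP[bu vb]]|/existsPn nb] := boolP [exists b, (b != u) && adj v b].
  by exists b, u.
(* With a single neighbour [u], [v] is a leaf and so is [u]; the pair is then a whole component, and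
   [G] is [K_2]. *)
have vE w : adj v w = (w == u).
  by apply/idP/eqP => [vw|->//]; apply/eqP; have := nb w; rewrite vw andbT negbK.
have uE w : adj u w = (w == v).
  by apply/idP/eqP => [|->]; [apply: W2_leaf_neighbour | rewrite adj_sym].
have uv : u != v by apply: contraTneq vu => ->; rewrite adj_irrefl.
have VT w : (w == v) || (w == u).
  have NV : nbhs [set v; u] = [set v; u].
    apply/setP=> z; apply/nbhsP/set2P.
      by case=> t /set2P[]->; rewrite ?vE ?uE => /eqP; auto.
    by case=> ->; [exists u | exists v]; rewrite ?set21 ?set22 // adj_sym.
  have h : [set v; u] = setT.
    by apply: nbhs_fixed => //; apply/set0Pn; exists v; rewrite set21.
  by have := in_setT w; rewrite -h !inE.
case: nK2; exists (fun w : G => if w == v then ord0 else ord_max : complete 2).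
  exists (fun i : 'I_2 => if i == ord0 then v else u) => [w|i] /=.
    by case: eqVneq (VT w) => [->//|_ /eqP->].
  by case: i => -[|[|//]] lti; apply/val_inj; rewrite /= ?eqxx // (negPf uv).
move=> x y /=; case: (eqVneq x v) (VT x) => [->|_ /eqP->];
  case: (eqVneq y v) (VT y) => [->|_ /eqP->];
  by rewrite ?adj_irrefl ?vE ?uE ?eqxx.
Qed.

Lemma W2_two_Omega_avoid v : exists S1 S2 : {set G},
  [/\ S1 \in Omega G, S2 \in Omega G, [disjoint S1 & S2] & v \notin S1 :|: S2].
Proof.
have [a [b [ab va vb]]] := W2_two_neighbours v.
have [|S1 [S2 [O1 O2 /subsetP sa /subsetP sb d]]] :=
    GW2 (independent1 a) (independent1 b).
  by rewrite disjoints1 inE.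
exists S1, S2; split=> //; rewrite in_setU negb_or.
have avoid S c : S \in Omega G -> c \in S -> adj v c -> v \notin S.
  by move=> /OmegaP[/independentP iS _] cS; apply: contraTN => vS; apply: iS.
by rewrite (avoid S1 a) ?(avoid S2 b) // ?sa ?sb ?set11.
Qed.

(** Monotonicity of the differential in subtraction-free form: independent sets are disjoint from
    their neighbourhoods. *)
Lemma W2_differential_card A B : A \subset B -> independent B ->
  #|nbhs A| + #|B| <= #|nbhs B| + #|A|.
Proof.
move=> sAB iB; have iA := independentW sAB iB.
have iD : independent (B :\: A) by apply: independentW iB; apply: subsetDl.
have [|S1 [S2 [O1 O2 /subsetP sA sD d]]] := GW2 iA iD.
  by rewrite -setI_eq0 setIDA setD_eq0 subsetIl.
have dD : [disjoint B :\: A & S1] by rewrite disjoint_sym; apply: disjointWr d.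
have le := Omega_exchange O1 iD dD.
(* [S1] is independent and contains [A], so neighbours of [B :\: A] in [S1] are not neighbours of
   [A]. *)
have d0 : nbhs A :&: (nbhs (B :\: A) :&: S1) = set0.
  apply/setP=> v; rewrite !in_setI in_set0; apply/and3P=> -[/nbhsP[u uA uv] _ vS].
  have /OmegaP[/independentP/(_ u v (sA u uA) vS)] := O1.
  by rewrite uv.
have : #|nbhs A :|: (nbhs (B :\: A) :&: S1)| <= #|nbhs B|.
  apply: subset_leq_card; rewrite subUset nbhsS //=.
  by apply: subset_trans (subsetIl _ _) _; apply: nbhsS; apply: subsetDl.
have := cardsID A B; rewrite (setIidPr sAB).
by rewrite cardsU d0 cards0 subn0; lia.
Qed.

Lemma W2_expand B : B != set0 -> independent B -> #|B| < #|nbhs B|.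
Proof.
case/set0Pn=> v vB iB; have [a [b [ab va vb]]] := W2_two_neighbours v.
have sv : [set v] \subset B by rewrite sub1set.
(* The differential of [[set v]] is at least 2 - 1, so that of [B] is positive. *)
have := W2_differential_card sv iB.
have : #|[set a; b]| <= #|nbhs [set v]|.
  apply: subset_leq_card; apply/subsetP=> c /set2P[]->;
    by apply/nbhsP; exists v; rewrite ?set11.
by rewrite cards2 ab cards1; lia.
Qed.

Lemma W2_card : 2 * alpha G + 1 <= #|G|.
Proof.
have [v _] : exists v : G, v \in G by apply/card_gt0P; exact: conn.1.
have [S1 [S2 [/OmegaP[_ c1] /OmegaP[_ c2] d vS]]] := W2_two_Omega_avoid v.
have : #|v |: (S1 :|: S2)| <= #|G| by apply: max_card.
by rewrite cardsU1 vS cardsU (disjoint_setI0 d) cards0 c1 c2; lia.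
Qed.

Lemma W2_matching A : independent A -> exists2 S, S \in Omega G &
  exists f : G -> G, [/\ matching [set [set x; f x] | x in A],
    #|[set [set x; f x] | x in A]| = #|A| & {in A, forall x, f x \in S}].
Proof.
move=> iA; have [S OS dS] := W2_disjoint_Omega iA.
have [f injf fP] := hall_Omega OS iA dS.
have [mM cM] := matching_of_injection dS injf fP.
by exists S => //; exists f; split=> // x /fP[].
Qed.

End W2.

Theorem theorem2p5 (G : sgraph) (hconn : connected G)
    (hK2 : ~ isomorphic G (complete 2)) (hW2 : W2 G) :
  (* (i) *)
  (forall v : G, exists S1 S2 : {set G},
     [/\ S1 \in Omega G, S2 \in Omega G, [disjoint S1 & S2]
       & v \notin S1 :|: S2]) /\
  (* (ii) *)
  (2 * alpha G + 1 <= #|G|) /\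
  (* (iii) *)
  (forall u v : G, exists2 S : {set G},
     S \in Omega G & S :&: [set u; v] = set0) /\
  (* (iv) *)
  (alpha G <= mu G /\ alpha G + mu G <= #|G| - 1) /\
  (* (v) *)
  (forall S : {set G}, independent S -> alpha G = alpha (remove S)) /\
  (* (vi) *)
  (forall A B : {set G}, A \subset B -> independent B ->
     (differential A <= differential B)%R) /\
  (* (vii) *)
  (regularizable G /\
   forall B : {set G}, B != set0 -> independent B -> #|B| < #|nbhs B|) /\
  (* (viii) *)
  (forall A : {set G}, independent A -> #|A| <= alpha (induced (nbhs A))) /\
  (* (ix) *)
  (forall A : {set G}, independent A ->
     exists (T : {set G}) (M : {set {set G}}),
       [/\ independent T, matching M
         & forall a : G, a \in A -> exists2 t, t \in T & [set a; t] \in M]).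
Proof.
have two := W2_two_Omega_avoid hconn hW2 hK2.
have cardG := W2_card hconn hW2 hK2.
have expand := W2_expand hconn hW2 hK2.
(* This closes (i), (ii) and the expansion half of (vii). *)
do ![split=> //].
- move=> u v; have [S1 [S2 [O1 O2 d]]] := two v.
  rewrite in_setU negb_or => /andP[v1 v2].
  have avoid (S : {set G}) : v \notin S -> u \notin S -> S :&: [set u; v] = set0.
    move=> vS uS; apply/setP=> z; rewrite in_setI in_set0.
    by apply/andP=> -[zS /set2P[] e]; move: zS; rewrite e; apply/negP.
  (* Of two disjoint sets avoiding [v], at most one contains [u]. *)
  have [u1|u1] := boolP (u \in S1); last by exists S1; auto.
  by exists S2 => //; apply: avoid => //; rewrite (disjointFr d).
- have [S OS _] := W2_disjoint_Omega hW2 (independent0 G).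
  have /OmegaP[iS cS] := OS.
  have [_ _ [f [mM cM _]]] := W2_matching hW2 iS.
  rewrite -cS -cM.
  exact: (leq_bigmax_cond (F := fun M : {set {set G}} => #|M|)).
(* Adding [2 * mu G <= #|G|] to (ii) bounds twice the sum by [2 * #|G| - 1]; parity gives the final
   -1. *)
- by have := double_mu G; lia.
- move=> S iS; apply/eqP; rewrite eqn_leq alpha_induced andbT.
  have [S1 /OmegaP[i1 <-] d] := W2_disjoint_Omega hW2 iS.
  by apply: leq_alpha_induced; rewrite // -disjoints_subset disjoint_sym.
- move=> A B sAB iB; have := W2_differential_card hW2 sAB iB.
  rewrite /differential !nbhs_disjoint //; last exact: independentW iB.
  by lia.
- have [x _] : exists v : G, v \in G by apply/card_gt0P; exact: hconn.1.
  have [y xy] := W2_has_neighbour hW2 x.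
  exact: regularizable_of_expand hconn expand _ _ xy.
- move=> A iA; have [S OS d] := W2_disjoint_Omega hW2 iA.
  (* [nbhs A :&: S] is the required independent set inside [nbhs A]. *)
  apply: leq_trans (Omega_exchange OS iA d) _.
  apply: leq_alpha_induced; first exact: subsetIl.
  by have /OmegaP[iS _] := OS; apply: independentW iS; apply: subsetIr.
move=> A iA; have [S /OmegaP[iS _] [f [mM _ fS]]] := W2_matching hW2 iA.
exists S, [set [set x; f x] | x in A]; split=> // a aA.
by exists (f a); [apply: fS | apply: imset_f].
Qed.
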